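(* Let $p\ge1$ be an integer, $G$ a nonvanishing log-harmonic mapping in $\mathbb{D}$, $\lambda_1,\dots,\lambda_p\in\mathbb{C}$, $f$ and $h$ nonzero constant functions in $\mathbb{D}$, and $F(z)=f(z)h(\overline z)\prod_{k=1}^{p}G(z)^{\lambda_k|z|^{2(k-1)}}$ for $z\in\mathbb{D}$. Suppose that $\log G$ and $\log F$ are univalent in $\mathbb{D}$, and that $\mathcal{L}[\log G(z)]\neq0$ and $\sum_{k=1}^{p}\lambda_k|z|^{2(k-1)}\neq0$ for all $z\in\mathbb{D}\setminus\{0\}$. Then $\log G$ is convex if and only if $\log F$ is convex.
   Context: $\mathbb{D}=\{z\in\mathbb{C}:|z|<1\}$; $\mathcal{L}=z\frac{\partial}{\partial z}-\overline{z}\frac{\partial}{\partial\overline{z}}$. A nonvanishing log-harmonic mapping $G$ in $\mathbb{D}$ is a nonvanishing solution of $\overline{G_{\overline z}}/\overline{G}=a\,G_z/G$ for some analytic function $a$; such $G$ is of the form $G=g_1\overline{g_2}$ with $g_1,g_2$ nonvanishing analytic functions in $\mathbb{D}$ (take this form as part of the definition). Thus $\log G=\log g_1+\overline{\log g_2}$, for fixed analytic branches of the logarithms, is a harmonic function in $\mathbb{D}$. Powers are defined by $G^{w}=\exp(w\log G)$ and, correspondingly, $\log F(z)=\log f+\log h+\Big(\sum_{k=1}^{p}\lambda_k|z|^{2(k-1)}\Big)\log G(z)$, where $\log f,\log h$ are fixed constants. A mapping $\Phi$ in $\mathbb{D}$ is polyharmonic if $\Delta^m\Phi=0$ for some $m\ge1$.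 A univalent (injective) polyharmonic mapping $\Phi$ in $\mathbb{D}$ with $\frac{\partial}{\partial t}\Phi(re^{it})\neq0$ whenever $0<r<1$ is called convex if $\frac{\partial}{\partial t}\Big(\arg\frac{\partial}{\partial t}\Phi(re^{it})\Big)>0$ for all $z=re^{it}\in\mathbb{D}\setminus\{0\}$ (i.e. the curve $t\mapsto\Phi(re^{it})$ is convex for each $0<r<1$). *)

(* Defs.v *)
From Stdlib Require Export Reals.
From Coquelicot Require Export Coquelicot.
Open Scope C_scope.

Definition in_disk (z : C) : Prop := (Cmod z < 1)%R.

Definition Cexp (z : C) : C := (exp (Re z) * cos (Im z), exp (Re z) * sin (Im z))%R.

Definition analytic_on_disk (f : C -> C) : Prop :=
  forall z0 : C, in_disk z0 ->
    exists (r : R) (a : nat -> C), (0 < r)%R /\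
      forall z : C, (Cmod (z - z0) < r)%R ->
        @is_pseries C_AbsRing C_NormedModule a (z - z0) (f z).

Definition nonvanishing_on_disk (f : C -> C) : Prop :=
  forall z : C, in_disk z -> f z <> 0.

Definition univalent_on_disk (f : C -> C) : Prop :=
  forall z w : C, in_disk z -> in_disk w -> f z = f w -> z = w.

(* Like [Derive], this is meaningful only where the derivative exists. *)
Definition Derive_RC (f : R -> C) (t : R) : C :=
  (Derive (fun s => Re (f s)) t, Derive (fun s => Im (f s)) t).

Definition ex_derive_RC (f : R -> C) (t : R) : Prop :=
  @ex_derive R_AbsRing C_R_NormedModule f t.

Definition d_x (f : C -> C) (z : C) : C := Derive_RC (fun x => f (x, Im z)) (Re z).
Definition d_y (f : C -> C) (z : C) : C := Derive_RC (fun y => f (Re z, y)) (Im z).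

Definition d_z (f : C -> C) (z : C) : C := (d_x f z - Ci * d_y f z) / 2.
Definition d_zbar (f : C -> C) (z : C) : C := (d_x f z + Ci * d_y f z) / 2.

Definition L_op (f : C -> C) (z : C) : C := z * d_z f z - Cconj z * d_zbar f z.

Definition laplacian (f : C -> C) (z : C) : C := d_x (d_x f) z + d_y (d_y f) z.

Fixpoint laplacian_iter (m : nat) (f : C -> C) : C -> C :=
  match m with
  | O => f
  | S m' => laplacian (laplacian_iter m' f)
  end.

(* [n] times continuously differentiable in the real sense on the disk. *)
Fixpoint C_n_on_disk (n : nat) (f : C -> C) : Prop :=
  (forall z : C, in_disk z -> @continuous C_UniformSpace C_UniformSpace f z) /\
  match n with
  | O => True
  | S n' =>
      (forall z : C, in_disk z ->
         ex_derive_RC (fun x => f (x, Im z)) (Re z) /\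
         ex_derive_RC (fun y => f (Re z, y)) (Im z)) /\
      C_n_on_disk n' (d_x f) /\ C_n_on_disk n' (d_y f)
  end.

(* The regularity makes the iterated Laplacian, built from total
   derivative operators, the genuine one. *)
Definition polyharmonic_on_disk (f : C -> C) : Prop :=
  exists m : nat, (1 <= m)%nat /\ C_n_on_disk (2 * m) f /\
    forall z : C, in_disk z -> laplacian_iter m f z = 0.

Definition log_harmonic_factors (G g1 g2 : C -> C) : Prop :=
  analytic_on_disk g1 /\ nonvanishing_on_disk g1 /\
  analytic_on_disk g2 /\ nonvanishing_on_disk g2 /\
  forall z : C, in_disk z -> G z = g1 z * Cconj (g2 z).

Definition nonvanishing_log_harmonic (G : C -> C) : Prop :=
  (exists g1 g2 : C -> C, log_harmonic_factors G g1 g2) /\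
  nonvanishing_on_disk G /\
  exists a : C -> C, analytic_on_disk a /\
    forall z : C, in_disk z ->
      Cconj (d_zbar G z) / Cconj (G z) = a z * (d_z G z / G z).

Definition analytic_log (g l : C -> C) : Prop :=
  analytic_on_disk l /\ forall z : C, in_disk z -> Cexp (l z) = g z.

(* [logG] is log G = log g1 + conj (log g2) for some choice of the factors
   and of analytic branches of their logarithms. *)
Definition log_harmonic_log (G logG : C -> C) : Prop :=
  exists g1 g2 l1 l2 : C -> C,
    log_harmonic_factors G g1 g2 /\ analytic_log g1 l1 /\ analytic_log g2 l2 /\
    forall z : C, in_disk z -> logG z = l1 z + Cconj (l2 z).

Fixpoint Cprod_1 (p : nat) (u : nat -> C) : C :=
  match p with
  | O => 1
  | S p' => Cprod_1 p' u * u (S p')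
  end.

Definition exponent (lambda : nat -> C) (k : nat) (z : C) : C :=
  lambda k * RtoC (Cmod z ^ (2 * (k - 1))).

Definition exponent_sum (p : nat) (lambda : nat -> C) (z : C) : C :=
  @sum_n_m C_AbelianGroup (fun k => exponent lambda k z) 1 p.

Definition power (w logG_z : C) : C := Cexp (w * logG_z).

Definition circle (r t : R) : C := RtoC r * Cexp (Ci * RtoC t).

Definition circle_tangent (Phi : C -> C) (r t : R) : C :=
  Derive_RC (fun s => Phi (circle r s)) t.

Definition continuous_arg (w : R -> C) (theta : R -> R) : Prop :=
  (forall t : R, continuous theta t) /\
  forall t : R, w t = RtoC (Cmod (w t)) * Cexp (Ci * RtoC (theta t)).

(* arg is multivalued: its derivative along a nonvanishing curve is that of a
   continuous branch, and two continuous branches differ by a constant. *)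
Definition convex_on_disk (Phi : C -> C) : Prop :=
  univalent_on_disk Phi /\ polyharmonic_on_disk Phi /\
  (forall r t : R, (0 < r < 1)%R -> circle_tangent Phi r t <> 0) /\
  (forall r : R, (0 < r < 1)%R ->
     exists theta : R -> R,
       continuous_arg (circle_tangent Phi r) theta /\
       forall t : R, ex_derive theta t /\ (0 < Derive theta t)%R).

(* Main.v *)
(** By termwise differentiation of power series, log G = l1 + conj l2 is smooth
    and harmonic. Almansi's argument then makes log F, a combination of the
    functions |z|^(2j) log G with j < p, polyharmonic of order p, since the
    Laplacian sends conj(z)^j a(z) to 4 j conj(z)^(j-1) a'(z). On the circle
    |z| = r the exponent is a nonzero constant S(r), so the tangents of log F
    are those of log G multiplied by S(r), and a continuous argument is only
    shifted by a constant. *)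

Require Import Defs.
From Stdlib Require Import Reals Lra Lia.
From Coquelicot Require Import Coquelicot.
Open Scope C_scope.

(** [Derive] is total and [laplacian_iter] nests it, so every nested derivative must be known to
    exist on the disk before its value means anything; [C_n_on_disk] asks for this up to order 2m.
    The class [almansi n] avoids computing these derivatives one by one: smoothness and the drop in
    n both become short inductions. Differentiability is taken in the real sense, f(z+h) = f(z) + A
    h + B conj(h) + o(h): conjugation then merely exchanges A and B up to conjugates, the product
    rule covers conj(z)^j a(z), and partial derivatives and tangents of circles are values of one
    linear map. Identities are available only on the open disk, hence the extension clause of the
    class. The equivalence is symmetric: the factor S(r) leads from log G to log F, and 1/S(r) leads
    back. *)

(** * Complex power series: the derived series and a quadratic remainder *)

Definition is_Cseries (u : nat -> C) (l : C) : Prop :=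
  @is_series C_AbsRing C_NormedModule u l.

Lemma is_pseries_Cpow (a : nat -> C) (w l : C) :
  @is_pseries C_AbsRing C_NormedModule a w l <->
  is_Cseries (fun n => w ^ n * a n) l.
Proof.
  assert (E : forall n, @pow_n C_Ring w n = w ^ n).
  { induction n as [|n IH]; [reflexivity|].
    simpl. rewrite IH. reflexivity. }
  unfold is_pseries, is_Cseries.
  split; apply is_series_ext; intros n.
  - change (@pow_n C_Ring w n * a n = w ^ n * a n). now rewrite (E n).
  - change (w ^ n * a n = @pow_n C_Ring w n * a n). now rewrite (E n).
Qed.

Lemma Cseries_norm_le (u : nat -> C) (v : nat -> R) (l : C) (k : R) :
  (forall n, Cmod (u n) <= v n)%R -> is_Cseries u l -> is_series v k ->
  (Cmod l <= k)%R.
Proof.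
  intros Huv Hu Hv.
  pose proof (@filterlim_le nat eventually _
    (fun n => Cmod (@sum_n C_AbelianGroup u n)) (sum_n v) (Cmod l) k) as H.
  apply H.
  - exists 0%nat. intros n _.
    eapply Rle_trans.
    + exact (@norm_sum_n_m C_AbsRing C_NormedModule u 0 n).
    + apply sum_n_m_le. exact Huv.
  - apply (filterlim_comp nat C R (@sum_n C_AbelianGroup u) Cmod eventually
      (@locally C_NormedModule l) (locally (Cmod l))).
    + exact Hu.
    + exact (@filterlim_norm C_AbsRing C_NormedModule l).
  - exact Hv.
Qed.

(** Partial sums of a convergent series are bounded, hence so are the terms, and a bound on |a_n|
    rho^n is a lower bound on the radius. This gives access to the theory of real power series
    through the moduli. *)
Lemma CV_radius_Cmod_ge (a : nat -> C) (rho : R) (l : C) :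
  (0 <= rho)%R -> is_Cseries (fun n => RtoC rho ^ n * a n) l ->
  Rbar_le rho (CV_radius (fun n => Cmod (a n))).
Proof.
  intros Hrho Hs.
  destruct (CV_radius_bounded (fun n => Cmod (a n))) as [Hub _].
  apply Hub.
  destruct (@filterlim_bounded C_AbsRing C_NormedModule
     (@sum_n C_AbelianGroup (fun n => RtoC rho ^ n * a n))) as [M HM].
  { exists l. exact Hs. }
  (* A term is the difference of two consecutive partial sums, each bounded by M. *)
  exists (M + M)%R. intros n.
  assert (E : (Cmod (a n) * rho ^ n = Cmod (RtoC rho ^ n * a n))%R).
  { rewrite Cmod_mult, Cmod_pow, Cmod_R, (Rabs_pos_eq rho) by assumption. ring. }
  rewrite E, Rabs_pos_eq by apply Cmod_ge_0.
  destruct n as [|n].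
  - specialize (HM 0%nat).
    rewrite sum_O in HM.
    change (Cmod (RtoC rho ^ 0 * a 0%nat) <= M)%R in HM.
    pose proof (Cmod_ge_0 (RtoC rho ^ 0 * a 0%nat)). lra.
  - pose proof (HM n) as H1. pose proof (HM (S n)) as H2.
    rewrite sum_Sn in H2.
    set (s := @sum_n C_AbelianGroup (fun n => RtoC rho ^ n * a n) n) in *.
    set (x := RtoC rho ^ S n * a (S n)) in *.
    change (Cmod s <= M)%R in H1. change (Cmod (s + x) <= M)%R in H2.
    replace x with ((s + x) + - s) by ring.
    eapply Rle_trans; [apply Cmod_triangle|].
    rewrite Cmod_opp. lra.
Qed.

(** Induction on n: the remainder is multiplied by w + h and gains (n+1) h^2 w^n, and n(n+1) + (n+1)
    <= (n+1)(n+2). The constant is twice the binomial one, which makes it the coefficient of a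
    second derivative. At n = 0 the factor [INR n] makes the value of [pred n] irrelevant. *)
Lemma Cpow_diff_le (w h : C) (rho : R) (n : nat) :
  (Cmod w <= rho)%R -> (Cmod (w + h) <= rho)%R ->
  (Cmod ((w + h) ^ S n - w ^ S n - RtoC (INR (S n)) * h * w ^ n) <=
   INR n * INR (S n) * rho ^ pred n * Cmod h ^ 2)%R.
Proof.
  intros Hw Hwh.
  pose proof (Cmod_ge_0 w) as Hw0. pose proof (Cmod_ge_0 h) as Hh0.
  assert (Hrho : (0 <= rho)%R) by lra.
  induction n as [|n IH].
  - simpl. replace (_ - _) with (RtoC 0) by ring.
    rewrite Cmod_0. lra.
  - assert (E : (w + h) ^ S (S n) - w ^ S (S n)
        - RtoC (INR (S (S n))) * h * w ^ S n =
      (w + h) * ((w + h) ^ S n - w ^ S n - RtoC (INR (S n)) * h * w ^ n)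
      + RtoC (INR (S n)) * h ^ 2 * w ^ n).
    { rewrite (S_INR (S n)), RtoC_plus. generalize (RtoC (INR (S n))).
      intros c. simpl. ring. }
    rewrite E. clear E.
    eapply Rle_trans; [apply Cmod_triangle|].
    rewrite !Cmod_mult, !Cmod_pow, Cmod_R.
    rewrite (Rabs_pos_eq (INR (S n))) by apply pos_INR.
    assert (Hp : (Cmod w ^ n <= rho ^ n)%R) by (apply pow_incr; lra).
    assert (H1 : (Cmod (w + h) * Cmod ((w + h) ^ S n - w ^ S n
       - RtoC (INR (S n)) * h * w ^ n) <=
       rho * (INR n * INR (S n) * rho ^ pred n * Cmod h ^ 2))%R).
    { apply Rmult_le_compat; try apply Cmod_ge_0; assumption. }
    assert (E2 : (rho * (INR n * INR (S n) * rho ^ pred n * Cmod h ^ 2) =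
      INR n * INR (S n) * rho ^ n * Cmod h ^ 2)%R).
    { destruct n; simpl; ring. }
    rewrite E2 in H1.
    assert (H2 : (INR (S n) * Cmod h ^ 2 * Cmod w ^ n <=
                  INR (S n) * Cmod h ^ 2 * rho ^ n)%R).
    { apply Rmult_le_compat_l; [|assumption].
      apply Rmult_le_pos; [apply pos_INR|apply pow_le; assumption]. }
    simpl (pred (S n)).
    assert (H3 : (0 <= INR (S n) * rho ^ n * Cmod h ^ 2)%R).
    { apply Rmult_le_pos; [apply Rmult_le_pos|]; try apply pos_INR;
      apply pow_le; assumption. }
    rewrite (S_INR (S n)). rewrite (S_INR n) in *. nra.
Qed.

Definition Cderive_coef (a : nat -> C) (n : nat) : C :=
  RtoC (INR (S n)) * a (S n).

(** The bound on the powers is summed against |a_(n+1)|. The resulting K is the second derived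
    series of the moduli at rho, which converges because differentiation preserves the radius of
    convergence. *)
Lemma Cpseries_quadratic_remainder (a : nat -> C) (w : C) (rho : R) :
  (Cmod w <= rho)%R -> Rbar_lt rho (CV_radius (fun n => Cmod (a n))) ->
  exists D K, is_Cseries (fun n => w ^ n * Cderive_coef a n) D /\
    forall (h l0 l1 : C), (Cmod (w + h) <= rho)%R ->
      is_Cseries (fun n => w ^ n * a n) l0 ->
      is_Cseries (fun n => (w + h) ^ n * a n) l1 ->
      (Cmod (l1 - l0 - D * h) <= K * Cmod h ^ 2)%R.
Proof.
  intros Hw Hcv.
  pose proof (Cmod_ge_0 w) as Hw0.
  assert (Hrho : (0 <= rho)%R) by lra.
  set (b := fun n => Cmod (a n)) in *.
  assert (Hcv1 : Rbar_lt (Rabs rho) (CV_radius (PS_derive b))).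
  { rewrite CV_radius_derive, Rabs_pos_eq; assumption. }
  assert (Hcv2 : Rbar_lt (Rabs rho) (CV_radius (PS_derive (PS_derive b)))).
  { rewrite CV_radius_derive. assumption. }
  assert (HD : @ex_series C_AbsRing C_NormedModule
     (fun n => w ^ n * Cderive_coef a n)).
  { apply (@ex_series_le C_AbsRing C_CompleteNormedModule _
             (fun n => Rabs (PS_derive b n * rho ^ n))).
    - intros n.
      change (Cmod (w ^ n * Cderive_coef a n) <= Rabs (PS_derive b n * rho ^ n))%R.
      unfold Cderive_coef, PS_derive, b.
      rewrite !Cmod_mult, Cmod_pow, Cmod_R.
      rewrite (Rabs_pos_eq (INR (S n))) by apply pos_INR.
      assert (Cmod w ^ n <= rho ^ n)%R by (apply pow_incr; lra).
      assert (0 <= INR (S n) * Cmod (a (S n)))%R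
        by (apply Rmult_le_pos; [apply pos_INR | apply Cmod_ge_0]).
      assert (0 <= rho ^ n)%R by (apply pow_le; assumption).
      rewrite Rabs_pos_eq by (apply Rmult_le_pos; assumption).
      rewrite Rmult_comm.
      apply Rmult_le_compat_l; assumption.
    - apply CV_disk_inside. assumption. }
  destruct HD as [D HD].
  set (v := fun n => (INR n * INR (S n) * rho ^ pred n * b (S n))%R).
  assert (Hv : ex_series v).
  { apply (proj2 (ex_series_incr_1 v)).
    eapply ex_series_ext; [|exact (CV_disk_inside _ _ Hcv2)].
    intros n. unfold v, PS_derive. rewrite Rabs_pos_eq.
    - change (INR (S n) * (INR (S (S n)) * b (S (S n))) * rho ^ n =
        INR (S n) * INR (S (S n)) * rho ^ n * b (S (S n)))%R. ring.
    - repeat apply Rmult_le_pos; try apply pos_INR; try apply Cmod_ge_0.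
      apply pow_le; assumption. }
  destruct Hv as [K HK].
  exists D, K. split; [exact HD|].
  intros h l0 l1 Hwh H0 H1.
  apply (Cseries_norm_le
    (fun n => ((w + h) ^ S n - w ^ S n - RtoC (INR (S n)) * h * w ^ n) * a (S n))
    (fun n => scal (Cmod h ^ 2)%R (v n))).
  - intros n. rewrite Cmod_mult.
    change (Cmod ((w + h) ^ S n - w ^ S n - RtoC (INR (S n)) * h * w ^ n) *
      Cmod (a (S n)) <= Cmod h ^ 2 * v n)%R.
    replace (Cmod h ^ 2 * v n)%R with
      ((INR n * INR (S n) * rho ^ pred n * Cmod h ^ 2) * Cmod (a (S n)))%R
      by (unfold v, b; ring).
    apply Rmult_le_compat_r; [apply Cmod_ge_0|].
    apply Cpow_diff_le; assumption.
  (* The constant term cancels in l1 - l0, so the difference is a series over the exponents n + 1,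
     aligned with the derived series. *)
  - assert (S01 : is_Cseries (fun n => ((w + h) ^ S n - w ^ S n) * a (S n)) (l1 - l0)).
    { unfold is_Cseries.
      apply (@is_series_incr_1 C_AbsRing C_NormedModule
         (fun n => ((w + h) ^ n - w ^ n) * a n)).
      match goal with |- is_series _ ?x => replace x with (l1 - l0) end.
      2:{ change (l1 - l0 = (l1 - l0) + (1 - 1) * a 0%nat). ring. }
      eapply is_series_ext; [|exact (@is_series_minus C_AbsRing C_NormedModule _ _ _ _ H1 H0)].
      intros n. change ((w + h) ^ n * a n - w ^ n * a n = ((w + h) ^ n - w ^ n) * a n).
      ring. }
    pose proof (@is_series_scal C_AbsRing C_NormedModule h _ _ HD) as SD.
    replace (D * h) with (h * D) by ring.
    eapply is_series_ext; [|exact (@is_series_minus C_AbsRing C_NormedModule _ _ _ _ S01 SD)].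
    intros n. change (((w + h) ^ S n - w ^ S n) * a (S n) -
      h * (w ^ n * (RtoC (INR (S n)) * a (S n))) =
      ((w + h) ^ S n - w ^ S n - RtoC (INR (S n)) * h * w ^ n) * a (S n)).
    ring.
  - rewrite Rmult_comm. apply (is_series_scal (Cmod h ^ 2)%R v K HK).
Qed.

(** * Real differentiability in Wirtinger form *)

(* Restores the type [C] that [ring] recognizes, hidden under normed-module
   projections. *)
Ltac C_ring :=
  repeat match goal with y : NormedModule.sort _ _ |- _ => change C in y end;
  match goal with |- @eq _ ?a ?b => change (@eq C a b) end; ring.

(* [A] and [B] are the derivatives of [f] with respect to [z] and [conj z]. *)
Definition wdiff (f : C -> C) (z A B : C) : Prop :=
  @filterdiff R_AbsRing C_R_NormedModule C_R_NormedModule f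
    (@locally C_R_NormedModule z) (fun h : C => A * h + B * Cconj h).

Definition is_derive_RC (u : R -> C) (t : R) (v : C) : Prop :=
  @is_derive R_AbsRing C_R_NormedModule u t v.

Lemma Cconj_RtoC (x : R) : Cconj (RtoC x) = RtoC x.
Proof. unfold Cconj, RtoC. simpl. f_equal. ring. Qed.

Lemma is_linear_wirtinger (A B : C) :
  @is_linear R_AbsRing C_R_NormedModule C_R_NormedModule
    (fun h : C => A * h + B * Cconj h).
Proof.
  constructor.
  - intros x y. change (A * (x + y) + B * Cconj (x + y) =
      (A * x + B * Cconj x) + (A * y + B * Cconj y)).
    rewrite Cplus_conj. C_ring.
  - intros k x. rewrite !scal_R_Cmult.
    change (A * (RtoC k * x) + B * Cconj (RtoC k * x) =
      RtoC k * (A * x + B * Cconj x)).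
    rewrite Cmult_conj, Cconj_RtoC. C_ring.
  - exists (Cmod A + Cmod B + 1)%R.
    pose proof (Cmod_ge_0 A). pose proof (Cmod_ge_0 B).
    split; [lra|]. intros x. rewrite <- !Cmod_norm.
    change (Cmod (A * x + B * Cconj x) <= (Cmod A + Cmod B + 1) * Cmod x)%R.
    eapply Rle_trans; [apply Cmod_triangle|].
    rewrite !Cmod_mult, Cmod_conj.
    pose proof (Cmod_ge_0 x). lra.
Qed.

Lemma locally_Cmod (z : C) (delta : R) (P : C -> Prop) :
  (0 < delta)%R -> (forall w : C, (Cmod (w - z) < delta)%R -> P w) ->
  @locally C_UniformSpace z P.
Proof.
  intros Hd HP. apply locally_C.
  exists (mkposreal delta Hd). intros w Hw. apply HP. exact Hw.
Qed.

Lemma locally_disk (z : C) : in_disk z -> @locally C_UniformSpace z in_disk.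
Proof.
  unfold in_disk. intros Hz.
  apply (locally_Cmod z (1 - Cmod z)); [lra|].
  intros w Hw. replace w with (z + (w - z)) by C_ring.
  eapply Rle_lt_trans; [apply Cmod_triangle|]. lra.
Qed.

Lemma filterdiff_quadratic (f lin : C -> C) (z : C) (K delta : R) :
  @is_linear R_AbsRing C_R_NormedModule C_R_NormedModule lin ->
  (0 < delta)%R ->
  (forall h : C, (Cmod h < delta)%R ->
     (Cmod (f (z + h)%C - f z - lin h) <= K * Cmod h ^ 2)%R) ->
  @filterdiff R_AbsRing C_R_NormedModule C_R_NormedModule f
    (@locally C_R_NormedModule z) lin.
Proof.
  intros Hl Hd HK. split; [exact Hl|].
  intros x Hx.
  apply (@is_filter_lim_locally_unique R_AbsRing C_R_NormedModule) in Hx.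
  subst x. intros eps.
  pose proof (cond_pos eps) as Heps.
  assert (HK1 : (0 < Rabs K + 1)%R) by (pose proof (Rabs_pos K); lra).
  assert (Hq : (0 < eps / (Rabs K + 1))%R) by (apply Rdiv_lt_0_compat; lra).
  (* Below the second radius K |h| <= eps, so the quadratic bound is at most eps |h|. K may have any
     sign, hence |K|; the added 1 keeps the denominator positive. *)
  apply (locally_Cmod z (Rmin delta (eps / (Rabs K + 1)))).
  { apply Rmin_glb_lt; assumption. }
  intros w Hw. rewrite <- !Cmod_norm.
  change (Cmod ((f w - f z) - lin (w - z)%C) <= eps * Cmod (w - z))%R.
  set (h := w - z) in *.
  assert (Hh1 : (Cmod h < delta)%R)
    by (eapply Rlt_le_trans; [exact Hw|apply Rmin_l]).
  assert (Hh2 : (Cmod h < eps / (Rabs K + 1))%R)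
    by (eapply Rlt_le_trans; [exact Hw|apply Rmin_r]).
  specialize (HK h Hh1).
  replace (z + h) with w in HK by (unfold h; ring).
  eapply Rle_trans; [exact HK|].
  pose proof (Cmod_ge_0 h) as Hh0.
  assert (H1 : (Cmod h * (Rabs K + 1) <= eps)%R).
  { apply Rlt_le. apply (Rmult_lt_compat_r (Rabs K + 1)) in Hh2; [|lra].
    replace (eps / (Rabs K + 1) * (Rabs K + 1))%R with (pos eps) in Hh2
      by (field; lra).
    exact Hh2. }
  pose proof (Rle_abs K) as HA.
  assert (K * Cmod h <= eps)%R by nra.
  simpl. rewrite Rmult_1_r, <- Rmult_assoc.
  apply Rmult_le_compat_r; assumption.
Qed.

Lemma wdiff_ext_disk (f g : C -> C) (z A B : C) :
  in_disk z -> (forall w, in_disk w -> f w = g w) ->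
  wdiff f z A B -> wdiff g z A B.
Proof.
  intros Hz E.
  apply (@filterdiff_ext_locally R_AbsRing C_R_NormedModule C_R_NormedModule).
  generalize (locally_disk z Hz). apply filter_imp. exact E.
Qed.

Lemma wdiff_eq (f : C -> C) (z A B A' B' : C) :
  wdiff f z A B -> A = A' -> B = B' -> wdiff f z A' B'.
Proof. intros H -> ->. exact H. Qed.

Lemma wdiff_const (c z : C) : wdiff (fun _ => c) z 0 0.
Proof.
  refine (filterdiff_ext_lin _ _ _
    (@filterdiff_const R_AbsRing C_R_NormedModule C_R_NormedModule _ _ c) _).
  intros y. change (RtoC 0 = 0 * y + 0 * Cconj y). C_ring.
Qed.

Lemma wdiff_id (z : C) : wdiff (fun w => w) z 1 0.
Proof.
  refine (filterdiff_ext_lin _ _ _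
    (@filterdiff_id R_AbsRing C_R_NormedModule _) _).
  intros y. change (y = 1 * y + 0 * Cconj y). C_ring.
Qed.

Lemma wdiff_plus (f g : C -> C) (z A B A' B' : C) :
  wdiff f z A B -> wdiff g z A' B' ->
  wdiff (fun w => f w + g w) z (A + A') (B + B').
Proof.
  intros Hf Hg.
  refine (filterdiff_ext_lin _ _ _
    (@filterdiff_plus_fct R_AbsRing C_R_NormedModule C_R_NormedModule _ _
      f g _ _ Hf Hg) _).
  intros y. change ((A * y + B * Cconj y) + (A' * y + B' * Cconj y) =
      (A + A') * y + (B + B') * Cconj y). C_ring.
Qed.

Lemma wdiff_conj (f : C -> C) (z A B : C) :
  wdiff f z A B -> wdiff (fun w => Cconj (f w)) z (Cconj B) (Cconj A).
Proof.
  intros Hf.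
  refine (filterdiff_ext_lin _ _ _
    (@filterdiff_comp' R_AbsRing C_R_NormedModule C_R_NormedModule
      C_R_NormedModule f Cconj z _ Cconj Hf _) _).
  - apply filterdiff_linear.
    constructor.
    + intros x y. apply Cplus_conj.
    + intros k x. rewrite !scal_R_Cmult.
      change (Cconj (RtoC k * x) = RtoC k * Cconj x).
      now rewrite Cmult_conj, Cconj_RtoC.
    + exists 1%R. split; [lra|]. intros x. rewrite <- !Cmod_norm.
      rewrite Cmod_conj. lra.
  - intros y. simpl. rewrite Cplus_conj, !Cmult_conj, Cconj_conj. C_ring.
Qed.

(** The remainder of the product at (u, v) is exactly (a - u)(b - v): near the point one factor is
    below eps, and the other is at most the norm of the increment. *)
Lemma filterdiff_Cmult (u v : C) :
  @filterdiff R_AbsRing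
    (prod_NormedModule R_AbsRing C_R_NormedModule C_R_NormedModule)
    C_R_NormedModule (fun q : C * C => fst q * snd q)
    (@locally (prod_NormedModule R_AbsRing C_R_NormedModule C_R_NormedModule)
      (u, v))
    (fun q : C * C => u * snd q + fst q * v).
Proof.
  set (V := prod_NormedModule R_AbsRing C_R_NormedModule C_R_NormedModule).
  assert (N1 : forall q : V, (Cmod (fst q) <= @norm R_AbsRing V q)%R).
  { intros [a b]. simpl fst. rewrite Cmod_norm.
    eapply Rle_trans; [|apply (norm_prod (U := C_R_NormedModule) a b)].
    apply Rmax_l. }
  assert (N2 : forall q : V, (Cmod (snd q) <= @norm R_AbsRing V q)%R).
  { intros [a b]. simpl snd. rewrite Cmod_norm.
    eapply Rle_trans; [|apply (norm_prod (U := C_R_NormedModule) a b)].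
    apply Rmax_r. }
  split.
  - constructor.
    + intros x y. change (u * (snd x + snd y) + (fst x + fst y) * v =
        (u * snd x + fst x * v) + (u * snd y + fst y * v)). C_ring.
    + intros k x. rewrite scal_R_Cmult.
      change (u * @scal R_Ring C_R_ModuleSpace k (snd x)
        + @scal R_Ring C_R_ModuleSpace k (fst x) * v =
        RtoC k * (u * snd x + fst x * v)).
      rewrite !scal_R_Cmult.
      change (u * (RtoC k * snd x) + (RtoC k * fst x) * v =
        RtoC k * (u * snd x + fst x * v)). C_ring.
    + exists (Cmod u + Cmod v + 1)%R.
      pose proof (Cmod_ge_0 u). pose proof (Cmod_ge_0 v).
      split; [lra|]. intros x. rewrite <- Cmod_norm.
      change (Cmod (u * snd x + fst x * v) <=
        (Cmod u + Cmod v + 1) * @norm R_AbsRing V x)%R.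
      eapply Rle_trans; [apply Cmod_triangle|].
      rewrite !Cmod_mult.
      pose proof (N1 x). pose proof (N2 x).
      pose proof (Cmod_ge_0 (fst x)). nra.
  - intros x Hx.
    apply (@is_filter_lim_locally_unique R_AbsRing V) in Hx.
    subst x. intros eps.
    assert (HL : @locally V (u, v) (fun q : V => (Cmod (fst q - u) < eps)%R)).
    { apply (@locally_le_locally_norm R_AbsRing V).
      exists eps. intros q Hq.
      eapply Rle_lt_trans; [|exact Hq].
      apply (N1 (@minus V q (u, v))). }
    revert HL. apply filter_imp. intros q Hq.
    rewrite <- Cmod_norm.
    set (d := @minus V q (u, v)).
    change (Cmod ((fst q * snd q - u * v) -
        (u * (snd q - v) + (fst q - u) * v)) <= eps * @norm R_AbsRing V d)%R.
    replace ((fst q * snd q - u * v) - (u * (snd q - v) + (fst q - u) * v))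
      with ((fst q - u) * (snd q - v)) by C_ring.
    rewrite Cmod_mult.
    apply Rmult_le_compat; try apply Cmod_ge_0; [lra|].
    apply (N2 d).
Qed.

Lemma wdiff_mult (f g : C -> C) (z A B A' B' : C) :
  wdiff f z A B -> wdiff g z A' B' ->
  wdiff (fun w => f w * g w) z
    (A * g z + f z * A') (B * g z + f z * B').
Proof.
  intros Hf Hg.
  refine (filterdiff_ext_lin _ _ _
    (@filterdiff_comp'_2 R_AbsRing C_R_NormedModule C_R_NormedModule
      C_R_NormedModule C_R_NormedModule f g Cmult z _ _
      (fun a b => f z * b + a * g z) Hf Hg (filterdiff_Cmult (f z) (g z))) _).
  intros y. simpl. C_ring.
Qed.

(** * Derivatives along curves, and the partial derivatives *)

Lemma is_derive_RC_parts (u : R -> C) (t : R) (v : C) :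
  is_derive_RC u t v ->
  is_derive (fun s => Re (u s)) t (Re v) /\ is_derive (fun s => Im (u s)) t (Im v).
Proof.
  intros Hu. split.
  - refine (filterdiff_ext_lin _ _ _
    (@filterdiff_comp' R_AbsRing R_NormedModule C_R_NormedModule R_NormedModule
      u fst t _ _ Hu
      (filterdiff_linear _ (@is_linear_fst R_AbsRing R_NormedModule R_NormedModule))) _).
    intros y. reflexivity.
  - refine (filterdiff_ext_lin _ _ _
    (@filterdiff_comp' R_AbsRing R_NormedModule C_R_NormedModule R_NormedModule
      u snd t _ _ Hu
      (filterdiff_linear _ (@is_linear_snd R_AbsRing R_NormedModule R_NormedModule))) _).
    intros y. reflexivity.
Qed.

Lemma is_derive_RC_pair (x y : R -> R) (t dx dy : R) :
  is_derive x t dx -> is_derive y t dy ->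
  is_derive_RC (fun s => (x s, y s)) t (dx, dy).
Proof.
  intros Hx Hy.
  refine (filterdiff_ext_lin _ _ _
    (@filterdiff_comp'_2 R_AbsRing R_NormedModule R_NormedModule R_NormedModule
      C_R_NormedModule x y (fun a b : R => (a, b)) t _ _ (fun a b => (a, b)) Hx Hy _) _).
  - apply filterdiff_ext_locally with (f := fun q : C_R_NormedModule => q).
    + apply filter_forall. intros [a b]. reflexivity.
    + eapply filterdiff_ext_lin; [apply filterdiff_id|].
      intros [a b]. reflexivity.
  - intros s. reflexivity.
Qed.

Lemma Derive_RC_unique (u : R -> C) (t : R) (v : C) :
  is_derive_RC u t v -> Derive_RC u t = v.
Proof.
  intros Hu. destruct (is_derive_RC_parts u t v Hu) as [H1 H2].
  apply is_derive_unique in H1. apply is_derive_unique in H2.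
  unfold Derive_RC. rewrite (surjective_pairing v). now f_equal.
Qed.

(** The common source of both partial derivatives, along horizontal and vertical lines, and of the
    tangents along circles. *)
Lemma wdiff_path (f : C -> C) (u : R -> C) (t : R) (v A B : C) :
  is_derive_RC u t v -> wdiff f (u t) A B ->
  is_derive_RC (fun s => f (u s)) t (A * v + B * Cconj v).
Proof.
  intros Hu Hf.
  refine (filterdiff_ext_lin _ _ _
    (@filterdiff_comp' R_AbsRing R_NormedModule C_R_NormedModule
      C_R_NormedModule u f t _ _ Hu Hf) _).
  intros y. rewrite !scal_R_Cmult.
  change (A * (RtoC y * v) + B * Cconj (RtoC y * v) =
      RtoC y * (A * v + B * Cconj v)).
  rewrite Cmult_conj, Cconj_RtoC. C_ring.
Qed.

Lemma wdiff_line_x (f : C -> C) (z A B : C) :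
  wdiff f z A B -> is_derive_RC (fun x => f (x, Im z)) (Re z) (A + B).
Proof.
  intros Hf.
  replace (A + B) with (A * (1%R, 0%R) + B * Cconj (1%R, 0%R)).
  - apply (wdiff_path f (fun x => (x, Im z))).
    + apply is_derive_RC_pair; [apply (@is_derive_id R_AbsRing)|apply (@is_derive_const R_AbsRing R_NormedModule)].
    + destruct z; exact Hf.
  - change (1%R, 0%R) with (RtoC 1). rewrite Cconj_RtoC. C_ring.
Qed.

Lemma wdiff_line_y (f : C -> C) (z A B : C) :
  wdiff f z A B ->
  is_derive_RC (fun y => f (Re z, y)) (Im z) (Ci * A + - Ci * B).
Proof.
  intros Hf.
  replace (Ci * A + - Ci * B) with (A * (0%R, 1%R) + B * Cconj (0%R, 1%R)).
  - apply (wdiff_path f (fun y => (Re z, y))).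
    + apply is_derive_RC_pair; [apply (@is_derive_const R_AbsRing R_NormedModule)|apply (@is_derive_id R_AbsRing)].
    + destruct z; exact Hf.
  - change (0%R, 1%R) with Ci.
    replace (Cconj Ci) with (- Ci); [C_ring|].
    unfold Cconj, Ci, Copp. simpl. f_equal. ring.
Qed.

Lemma d_x_wdiff (f : C -> C) (z A B : C) : wdiff f z A B -> d_x f z = A + B.
Proof. intros Hf. apply Derive_RC_unique, wdiff_line_x, Hf. Qed.

Lemma d_y_wdiff (f : C -> C) (z A B : C) :
  wdiff f z A B -> d_y f z = Ci * A + - Ci * B.
Proof. intros Hf. apply Derive_RC_unique, wdiff_line_y, Hf. Qed.

Lemma wdiff_continuous (f : C -> C) (z A B : C) :
  wdiff f z A B -> @continuous C_UniformSpace C_UniformSpace f z.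
Proof.
  intros Hf.
  apply (@filterdiff_continuous R_AbsRing C_R_NormedModule C_R_NormedModule).
  eexists. exact Hf.
Qed.

(** * Analytic functions on the disk *)

(** As the derivative with respect to conj z vanishes, [d_x f] is the complex derivative and serves
    as its name throughout. The local claim [key] differentiates an expansion at every point of its
    disc, not only at the centre, so that the derived series represents [d_x f] on that whole
    disc. *)
Lemma analytic_derivative (f : C -> C) :
  analytic_on_disk f ->
  analytic_on_disk (d_x f) /\
  forall z, in_disk z -> wdiff f z (d_x f z) 0.
Proof.
  intros Hf.
  assert (key : forall z0 r a, (0 < r)%R ->
    (forall z : C, (Cmod (z - z0) < r)%R ->
      @is_pseries C_AbsRing C_NormedModule a (z - z0) (f z)) ->
    forall z, (Cmod (z - z0) < r)%R ->
      wdiff f z (d_x f z) 0 /\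
      @is_pseries C_AbsRing C_NormedModule (Cderive_coef a) (z - z0) (d_x f z)).
  { intros z0 r a Hr Ha z Hz.
    set (w := z - z0) in *.
    (* Two radii with |w| < rho < rho' < r: convergence at rho' puts the radius of convergence
       strictly above rho, and rho - |w| is the room left for increments. *)
    set (rho := ((Cmod w + r) / 2)%R).
    set (rho' := ((rho + r) / 2)%R).
    pose proof (Cmod_ge_0 w) as Hw0.
    assert (Hrho : (Cmod w < rho)%R) by (unfold rho; lra).
    assert (Hrho' : (rho < rho' < r)%R) by (unfold rho', rho; lra).
    assert (Hcv : Rbar_lt rho (CV_radius (fun n => Cmod (a n)))).
    { apply Rbar_lt_le_trans with (y := Finite rho'); [simpl; lra|].
      apply (CV_radius_Cmod_ge a rho' (f (z0 + RtoC rho'))); [lra|].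
      apply is_pseries_Cpow.
      pose proof (Ha (z0 + RtoC rho')) as H.
      replace (z0 + RtoC rho' - z0) with (RtoC rho') in H by ring.
      apply H. rewrite Cmod_R, Rabs_pos_eq; lra. }
    destruct (Cpseries_quadratic_remainder a w rho (Rlt_le _ _ Hrho) Hcv)
      as (D & K & HD & HK).
    assert (HW : wdiff f z D 0).
    { apply (filterdiff_quadratic f _ z K (rho - Cmod w)).
      - apply is_linear_wirtinger.
      - lra.
      - intros h Hh.
        assert (Hwh : (Cmod (w + h) <= rho)%R).
        { eapply Rle_trans; [apply Cmod_triangle|]. lra. }
        replace (f (z + h) - f z - (D * h + 0 * Cconj h))
          with (f (z + h) - f z - D * h) by ring.
        apply (HK h).
        + exact Hwh.
        + apply is_pseries_Cpow. unfold w. apply Ha. exact Hz.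
        + apply is_pseries_Cpow.
          pose proof (Ha (z + h)) as H.
          replace (z + h - z0) with (w + h) in H by (unfold w; ring).
          apply H. lra. }
    assert (E : d_x f z = D) by (rewrite (d_x_wdiff _ _ _ _ HW); ring).
    rewrite E. split; [exact HW|].
    apply is_pseries_Cpow. exact HD. }
  split.
  - intros z0 Hz0. destruct (Hf z0 Hz0) as (r & a & Hr & Ha).
    exists r, (Cderive_coef a). split; [exact Hr|].
    intros z Hz. apply (key z0 r a Hr Ha z Hz).
  - intros z Hz. destruct (Hf z Hz) as (r & a & Hr & Ha).
    apply (key z r a Hr Ha).
    replace (z - z) with (RtoC 0) by ring. rewrite Cmod_0. exact Hr.
Qed.

Lemma analytic_scal (c : C) (f : C -> C) :
  analytic_on_disk f -> analytic_on_disk (fun z => c * f z).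
Proof.
  intros Hf z0 Hz0. destruct (Hf z0 Hz0) as (r & a & Hr & Ha).
  exists r, (fun n => c * a n). split; [exact Hr|].
  intros z Hz.
  apply (@is_pseries_scal C_AbsRing C_NormedModule c a); [apply Cmult_comm|].
  apply Ha, Hz.
Qed.

(** Since z = (z - z0) + z0, multiplication by z shifts the coefficients and adds a multiple of
    them; no Cauchy product is involved. *)
Lemma analytic_mult_id (f : C -> C) :
  analytic_on_disk f -> analytic_on_disk (fun z => z * f z).
Proof.
  intros Hf z0 Hz0. destruct (Hf z0 Hz0) as (r & a & Hr & Ha).
  exists r. eexists. split; [exact Hr|].
  intros z Hz.
  replace (z * f z) with ((z - z0) * f z + z0 * f z) by ring.
  apply (@is_pseries_plus C_AbsRing C_NormedModule).
  - apply (@is_pseries_incr_1 C_AbsRing C_NormedModule). apply Ha, Hz.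
  - apply (@is_pseries_scal C_AbsRing C_NormedModule z0 a); [apply Cmult_comm|].
    apply Ha, Hz.
Qed.

Lemma analytic_mult_pow (j : nat) (f : C -> C) :
  analytic_on_disk f -> analytic_on_disk (fun z => z ^ j * f z).
Proof.
  intros Hf. induction j as [|j IH].
  - intros z0 Hz0. destruct (analytic_scal 1 f Hf z0 Hz0) as (r & a & H).
    now exists r, a.
  - intros z0 Hz0. destruct (analytic_mult_id _ IH z0 Hz0) as (r & a & Hr & H).
    exists r, a. split; [exact Hr|]. intros z Hz.
    replace (z ^ S j * f z) with (z * (z ^ j * f z)) by (simpl; ring).
    apply H, Hz.
Qed.

(** * The Almansi class and polyharmonicity *)

Lemma wdiff_conj_pow (j : nat) (z : C) :
  wdiff (fun w => Cconj w ^ j) z 0 (RtoC (INR j) * Cconj z ^ pred j).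
Proof.
  induction j as [|j IH].
  - simpl. replace (RtoC 0 * 1) with (RtoC 0) by ring. apply wdiff_const.
  - eapply wdiff_eq.
    + exact (wdiff_mult _ _ _ _ _ _ _ (wdiff_conj _ _ _ _ (wdiff_id z)) IH).
    + rewrite Cconj_RtoC. ring.
    + rewrite Cconj_RtoC, S_INR, RtoC_plus. destruct j; simpl; ring.
Qed.

(* A class closed under both partial derivatives, on which the Laplacian
   lowers [n]. *)
Inductive almansi (n : nat) : (C -> C) -> Prop :=
| almansi_zero : almansi n (fun _ => 0)
| almansi_const (c : C) : (0 < n)%nat -> almansi n (fun _ => c)
| almansi_mono (j : nat) (a : C -> C) : (j < n)%nat -> analytic_on_disk a ->
    almansi n (fun z => Cconj z ^ j * a z)
| almansi_conj (f : C -> C) : almansi n f -> almansi n (fun z => Cconj (f z))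
| almansi_plus (f g : C -> C) : almansi n f -> almansi n g ->
    almansi n (fun z => f z + g z)
| almansi_ext (f g : C -> C) : almansi n f ->
    (forall z, in_disk z -> f z = g z) -> almansi n g.

(** The scalar is quantified after the induction hypothesis because in the conjugate case it enters
    as its own conjugate: c conj(f) = conj(conj(c) f). *)
Lemma almansi_scal (n : nat) (f : C -> C) :
  almansi n f -> forall c, almansi n (fun z => c * f z).
Proof.
  induction 1 as [|c' Hn|j a Hj Ha|f Hf IH|f g Hf IHf Hg IHg|f g Hf IH E];
    intros c.
  - apply almansi_ext with (1 := almansi_zero n). intros; ring.
  - apply (almansi_const n (c * c')), Hn.
  - apply almansi_ext with
      (1 := almansi_mono n j _ Hj (analytic_scal c a Ha)). intros; ring.
  - apply almansi_ext with (1 := almansi_conj n _ (IH (Cconj c))).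
    intros. now rewrite Cmult_conj, Cconj_conj.
  - apply almansi_ext with (1 := almansi_plus n _ _ (IHf c) (IHg c)).
    intros; ring.
  - apply almansi_ext with (1 := IH c). intros z Hz. now rewrite E.
Qed.

(** For n = 0 the conditions [0 < n] and [j < n] exclude every generator but zero. This is where the
    iterated Laplacian ends. *)
Lemma almansi_0 (n : nat) (f : C -> C) :
  almansi n f -> n = 0%nat -> forall z, in_disk z -> f z = 0.
Proof.
  induction 1 as [|c' Hn|j a Hj Ha|f Hf IH|f g Hf IHf Hg IHg|f g Hf IH E];
    intros En z Hz; try lia.
  - reflexivity.
  - rewrite IH; trivial. apply Cconj_RtoC.
  - rewrite IHf, IHg; trivial. ring.
  - rewrite <- E; auto.
Qed.

Definition wderiv (f fz fzb : C -> C) : Prop :=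
  forall z, in_disk z -> wdiff f z (fz z) (fzb z).

Lemma wderiv_ext (f g fz fzb gz gzb : C -> C) :
  wderiv f fz fzb ->
  (forall z, in_disk z -> f z = g z) ->
  (forall z, in_disk z -> fz z = gz z) ->
  (forall z, in_disk z -> fzb z = gzb z) ->
  wderiv g gz gzb.
Proof.
  intros H E Ez Ezb z Hz.
  apply (wdiff_ext_disk f g); trivial.
  rewrite <- Ez, <- Ezb by assumption. apply H, Hz.
Qed.

Lemma wderiv_mono (j : nat) (a : C -> C) :
  analytic_on_disk a ->
  wderiv (fun z => Cconj z ^ j * a z) (fun z => Cconj z ^ j * d_x a z)
    (fun z => Cconj z ^ pred j * (RtoC (INR j) * a z)).
Proof.
  intros Ha z Hz.
  eapply wdiff_eq.
  - exact (wdiff_mult _ _ _ _ _ _ _ (wdiff_conj_pow j z)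
      (proj2 (analytic_derivative a Ha) z Hz)).
  - cbv beta. ring.
  - cbv beta. ring.
Qed.

(* The same [g] is both mixed derivatives, so that the Laplacian is [4 g]. *)
Lemma almansi_derivatives (n : nat) (f : C -> C) :
  almansi n f ->
  exists fz fzb fzz g fzbzb : C -> C,
    wderiv f fz fzb /\ wderiv fz fzz g /\ wderiv fzb g fzbzb /\
    almansi n fz /\ almansi n fzb /\ almansi (pred n) g.
Proof.
  induction 1 as [|c Hn|j a Hj Ha|f Hf IH|f g Hf IHf Hg IHg|f g Hf IH E].
  - exists (fun _ => 0), (fun _ => 0), (fun _ => 0), (fun _ => 0), (fun _ => 0).
    split; [|split; [|split; [|split; [|split]]]];
      try apply almansi_zero; intros z _; apply wdiff_const.
  - exists (fun _ => 0), (fun _ => 0), (fun _ => 0), (fun _ => 0), (fun _ => 0).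
    split; [|split; [|split; [|split; [|split]]]];
      try apply almansi_zero; intros z _; apply wdiff_const.
  - destruct (analytic_derivative a Ha) as [Ha' Hda].
    pose proof (analytic_scal (RtoC (INR j)) a Ha) as Hja.
    (* Differentiating the conj z derivative produces [d_x] of the product j a; it has to become j
       a' for both mixed derivatives to be one function. *)
    assert (Hd : forall z, in_disk z ->
      d_x (fun z => RtoC (INR j) * a z) z = RtoC (INR j) * d_x a z).
    { intros z Hz.
      rewrite (d_x_wdiff _ _ _ _ (wdiff_mult _ _ _ _ _ _ _
         (wdiff_const (RtoC (INR j)) z) (Hda z Hz))). ring. }
    exists (fun z => Cconj z ^ j * d_x a z),
      (fun z => Cconj z ^ pred j * (RtoC (INR j) * a z)),
      (fun z => Cconj z ^ j * d_x (d_x a) z),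
      (fun z => Cconj z ^ pred j * (RtoC (INR j) * d_x a z)),
      (fun z => Cconj z ^ pred (pred j) *
         (RtoC (INR (pred j)) * (RtoC (INR j) * a z))).
    split; [|split; [|split; [|split; [|split]]]].
    + apply wderiv_mono, Ha.
    + apply wderiv_mono, Ha'.
    + refine (wderiv_ext _ _ _ _ _ _ (wderiv_mono (pred j) _ Hja) _ _ _);
        intros z Hz; simpl; trivial. now rewrite Hd.
    + now apply almansi_mono.
    + apply almansi_mono; [lia|exact Hja].
    (* The mixed derivative has lost one power of conj z. For j = 0 it vanishes through [INR 0], and
       it must be treated apart because [pred n] may be 0. *)
    + destruct j as [|j].
      * apply almansi_ext with (1 := almansi_zero _). intros. simpl. ring.
      * apply almansi_mono; [simpl; lia|]. now apply analytic_scal.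
  - destruct IH as (fz & fzb & fzz & g & fzbzb & H1 & H2 & H3 & A1 & A2 & A3).
    (* Conjugation exchanges the roles of z and conj z and keeps the mixed derivative in the
       middle. *)
    exists (fun z => Cconj (fzb z)), (fun z => Cconj (fz z)),
      (fun z => Cconj (fzbzb z)), (fun z => Cconj (g z)),
      (fun z => Cconj (fzz z)).
    split; [|split; [|split; [|split; [|split]]]];
      try (now apply almansi_conj); intros z Hz; apply wdiff_conj; auto.
  - destruct IHf as (fz & fzb & fzz & m & fzbzb & H1 & H2 & H3 & A1 & A2 & A3).
    destruct IHg as (gz & gzb & gzz & k & gzbzb & H1' & H2' & H3' & B1 & B2 & B3).
    exists (fun z => fz z + gz z), (fun z => fzb z + gzb z),
      (fun z => fzz z + gzz z), (fun z => m z + k z),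
      (fun z => fzbzb z + gzbzb z).
    split; [|split; [|split; [|split; [|split]]]];
      try (now apply almansi_plus); intros z Hz; apply wdiff_plus; auto.
  - destruct IH as (fz & fzb & fzz & m & fzbzb & H1 & H).
    exists fz, fzb, fzz, m, fzbzb. split; [|exact H].
    apply (wderiv_ext f g fz fzb fz fzb); auto.
Qed.

Lemma almansi_d_x (n : nat) (f : C -> C) : almansi n f -> almansi n (d_x f).
Proof.
  intros Hf. destruct (almansi_derivatives n f Hf)
    as (fz & fzb & _ & _ & _ & H1 & _ & _ & A1 & A2 & _).
  apply almansi_ext with (1 := almansi_plus n _ _ A1 A2).
  intros z Hz. symmetry. apply d_x_wdiff, H1, Hz.
Qed.

Lemma almansi_d_y (n : nat) (f : C -> C) : almansi n f -> almansi n (d_y f).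
Proof.
  intros Hf. destruct (almansi_derivatives n f Hf)
    as (fz & fzb & _ & _ & _ & H1 & _ & _ & A1 & A2 & _).
  apply almansi_ext with (1 := almansi_plus n _ _
    (almansi_scal n _ A1 Ci) (almansi_scal n _ A2 (- Ci))).
  intros z Hz. symmetry. apply d_y_wdiff, H1, Hz.
Qed.

(** With d_x = d_z + d_zbar and d_y = i (d_z - d_zbar), the pure second derivatives cancel because
    i^2 = -1, and each of the two squares contributes 2 g. *)
Lemma almansi_laplacian (n : nat) (f : C -> C) :
  almansi n f -> almansi (pred n) (laplacian f).
Proof.
  intros Hf. destruct (almansi_derivatives n f Hf)
    as (fz & fzb & fzz & g & fzbzb & H1 & H2 & H3 & _ & _ & A3).
  apply almansi_ext with (1 := almansi_scal _ _ A3 4).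
  intros z Hz. unfold laplacian.
  assert (Hx : wdiff (d_x f) z (fzz z + g z) (g z + fzbzb z)).
  { apply (wdiff_ext_disk (fun w => fz w + fzb w)); trivial.
    - intros w Hw. symmetry. apply d_x_wdiff, H1, Hw.
    - apply wdiff_plus; auto. }
  assert (Hy : wdiff (d_y f) z (Ci * fzz z + - Ci * g z)
                               (Ci * g z + - Ci * fzbzb z)).
  { apply (wdiff_ext_disk (fun w => Ci * fz w + - Ci * fzb w)); trivial.
    - intros w Hw. symmetry. apply d_y_wdiff, H1, Hw.
    - eapply wdiff_eq.
      + exact (wdiff_plus _ _ _ _ _ _ _
          (wdiff_mult _ _ _ _ _ _ _ (wdiff_const Ci z) (H2 z Hz))
          (wdiff_mult _ _ _ _ _ _ _ (wdiff_const (- Ci) z) (H3 z Hz))).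
      + cbv beta. ring.
      + cbv beta. ring. }
  rewrite (d_x_wdiff _ _ _ _ Hx), (d_y_wdiff _ _ _ _ Hy).
  replace (Ci * (Ci * fzz z + - Ci * g z) + - Ci * (Ci * g z + - Ci * fzbzb z))
    with (Ci * Ci * (fzz z - g z - g z + fzbzb z)) by ring.
  replace (Ci * Ci) with (- (1)); [ring|].
  unfold Ci, Cmult, Copp, RtoC. simpl. f_equal; ring.
Qed.

(** The order m of smoothness is independent of n: closure under [d_x] and [d_y] carries the
    induction on m. *)
Lemma almansi_C_n (m n : nat) (f : C -> C) : almansi n f -> C_n_on_disk m f.
Proof.
  revert f. induction m as [|m IH]; intros f Hf;
    destruct (almansi_derivatives n f Hf)
      as (fz & fzb & _ & _ & _ & H1 & _);
    (split; [intros z Hz; exact (wdiff_continuous _ _ _ _ (H1 z Hz))|]).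
  - exact I.
  - split; [|split].
    + intros z Hz. split; eexists.
      * exact (wdiff_line_x _ _ _ _ (H1 z Hz)).
      * exact (wdiff_line_y _ _ _ _ (H1 z Hz)).
    + apply IH, almansi_d_x, Hf.
    + apply IH, almansi_d_y, Hf.
Qed.

Lemma almansi_laplacian_iter (k m : nat) (f : C -> C) :
  almansi (k + m) f -> almansi m (laplacian_iter k f).
Proof.
  revert m. induction k as [|k IH]; intros m Hf; [exact Hf|].
  (* [laplacian_iter] adds its Laplacian on the outside, so the induction hypothesis is used one
     level higher, at m + 1. *)
  apply (almansi_laplacian (S m)), IH.
  now rewrite Nat.add_succ_r.
Qed.

Lemma almansi_polyharmonic (n : nat) (f : C -> C) :
  (1 <= n)%nat -> almansi n f -> polyharmonic_on_disk f.
Proof.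
  intros Hn Hf. exists n. split; [exact Hn|]. split.
  - exact (almansi_C_n _ n f Hf).
  - apply (almansi_0 0); [|reflexivity].
    apply almansi_laplacian_iter. now rewrite Nat.add_0_r.
Qed.

(** In |z|^(2j) = conj(z)^j z^j the power z^j is absorbed into the analytic factor. The term with
    conj(l2) is the conjugate of one of the same shape. *)
Lemma almansi_Cmod_pow_mult (n j : nat) (l1 l2 : C -> C) :
  (j < n)%nat -> analytic_on_disk l1 -> analytic_on_disk l2 ->
  almansi n (fun z => RtoC (Cmod z ^ (2 * j)) * (l1 z + Cconj (l2 z))).
Proof.
  intros Hj H1 H2.
  apply almansi_ext with (1 := almansi_plus n _ _
    (almansi_mono n j _ Hj (analytic_mult_pow j _ H1))
    (almansi_conj n _ (almansi_mono n j _ Hj (analytic_mult_pow j _ H2)))).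
  intros z _.
  rewrite pow_mult, RtoC_pow, Cmod2_conj, Cpow_mult_l.
  rewrite !Cmult_conj, !Cpow_conj, Cconj_conj. ring.
Qed.

(** The number p of terms varies in the induction while the order n stays fixed. Indices start at 1,
    so the term of index p + 1 carries |z|^(2p), and p < n suffices. *)
Lemma almansi_exponent_sum (p n : nat) (lambda : nat -> C) (l1 l2 : C -> C) :
  (p <= n)%nat -> analytic_on_disk l1 -> analytic_on_disk l2 ->
  almansi n (fun z => exponent_sum p lambda z * (l1 z + Cconj (l2 z))).
Proof.
  intros Hp H1 H2. unfold exponent_sum.
  induction p as [|p IH].
  - apply almansi_ext with (1 := almansi_zero n). intros z _.
    rewrite sum_n_m_zero by lia.
    change (RtoC 0 = RtoC 0 * (l1 z + Cconj (l2 z))). ring.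
  - apply almansi_ext with (1 := almansi_plus n _ _ (IH ltac:(lia))
      (almansi_scal n _ (almansi_Cmod_pow_mult n p l1 l2 ltac:(lia) H1 H2)
         (lambda (S p)))).
    intros z _. rewrite sum_n_Sm by lia.
    unfold exponent at 3.
    replace (S p - 1)%nat with p by lia.
    match goal with |- context [@sum_n_m ?G ?u 1 p] =>
      set (s := @sum_n_m G u 1 p) end.
    change (s * (l1 z + Cconj (l2 z)) + lambda (S p) *
      (RtoC (Cmod z ^ (2 * p)) * (l1 z + Cconj (l2 z))) =
      (s + lambda (S p) * RtoC (Cmod z ^ (2 * p))) * (l1 z + Cconj (l2 z))).
    ring.
Qed.

(** * Polar form and circles *)

Lemma Cexp_Ci (t : R) : Cexp (Ci * RtoC t) = (cos t, sin t).
Proof.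
  unfold Cexp, Ci, RtoC, Cmult, Re, Im. simpl.
  replace (0 * t - 1 * 0)%R with 0%R by ring.
  replace (0 * 0 + 1 * t)%R with t by ring.
  rewrite exp_0. f_equal; ring.
Qed.

Lemma Cmod_Cexp_Ci (t : R) : Cmod (Cexp (Ci * RtoC t)) = 1%R.
Proof.
  rewrite Cexp_Ci. unfold Cmod, fst, snd.
  rewrite <- !Rsqr_pow2, Rplus_comm, sin2_cos2. apply sqrt_1.
Qed.

Lemma Cexp_Ci_plus (s t : R) :
  Cexp (Ci * RtoC (s + t)) = Cexp (Ci * RtoC s) * Cexp (Ci * RtoC t).
Proof.
  rewrite !Cexp_Ci, cos_plus, sin_plus. unfold Cmult. simpl. f_equal; ring.
Qed.

(** For w = x + iy nonzero, acos(x/|w|) is an argument up to the sign, which is that of y, because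
    sin(acos u) = sqrt(1 - u^2) gives |y|/|w|. At w = 0 any t works. *)
Lemma Cpolar (w : C) : exists t : R, w = RtoC (Cmod w) * Cexp (Ci * RtoC t).
Proof.
  destruct (Ceq_dec w 0) as [->|Hw].
  - exists 0%R. rewrite Cmod_0. ring.
  - apply Cmod_gt_0 in Hw.
    destruct w as [x y]. set (m := Cmod (x, y)) in *.
    assert (Hm : (m ^ 2 = x ^ 2 + y ^ 2)%R) by apply Cmod2_alt.
    assert (Hx : (-1 <= x / m <= 1)%R).
    { split; apply (Rmult_le_reg_r m); trivial;
        unfold Rdiv; rewrite Rmult_assoc, Rinv_l by lra; nra. }
    assert (Hs : (sqrt (1 - (x / m)²) = Rabs y / m)%R).
    { replace (1 - (x / m)²)%R with ((Rabs y / m)²)%R.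
      - apply sqrt_Rsqr. apply Rdiv_le_0_compat; [apply Rabs_pos|lra].
      - assert (E : (Rabs y * Rabs y = y * y)%R)
          by (rewrite <- Rabs_mult; apply Rabs_pos_eq; nra).
        unfold Rsqr, Rdiv.
        replace (Rabs y * / m * (Rabs y * / m))%R
          with ((Rabs y * Rabs y) * / m * / m)%R by ring.
        rewrite E. replace (y * y)%R with (m ^ 2 - x * x)%R by nra.
        field. lra. }
    destruct (Rle_lt_dec 0 y) as [Hy|Hy].
    + exists (acos (x / m)). rewrite Cexp_Ci, cos_acos, sin_acos, Hs by assumption.
      rewrite Rabs_pos_eq by assumption.
      unfold Cmult, RtoC. simpl. f_equal; field; lra.
    + exists (- acos (x / m))%R.
      rewrite Cexp_Ci, cos_neg, sin_neg, cos_acos, sin_acos, Hs by assumption.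
      rewrite Rabs_left by assumption.
      unfold Cmult, RtoC. simpl. f_equal; field; lra.
Qed.

Lemma is_derive_circle (r t : R) : is_derive_RC (circle r) t (Ci * circle r t).
Proof.
  assert (E : forall s, (r * cos s, r * sin s)%R = circle r s).
  { intros s. unfold circle. rewrite Cexp_Ci. unfold Cmult, RtoC. simpl.
    f_equal; ring. }
  unfold is_derive_RC.
  apply (@is_derive_ext R_AbsRing C_R_NormedModule
    (fun s => (r * cos s, r * sin s)%R)); [exact E|].
  rewrite <- E.
  replace (Ci * (r * cos t, r * sin t)%R) with (r * - sin t, r * cos t)%R.
  - apply is_derive_RC_pair; auto_derive; trivial; ring.
  - unfold Cmult, Ci. simpl. f_equal; ring.
Qed.

Lemma Cmod_circle (r t : R) : (0 <= r)%R -> Cmod (circle r t) = r.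
Proof.
  intros Hr. unfold circle.
  rewrite Cmod_mult, Cmod_R, Cmod_Cexp_Ci, Rabs_pos_eq by assumption. ring.
Qed.

(** * Tangents along circles and transfer of convexity *)

(** Chain rule through the affine map w -> c + s w. Psi is compared with Phi on the single circle of
    radius r only, so s may change from one circle to another without any derivative of s
    appearing. *)
Lemma circle_tangent_affine (Phi Psi : C -> C) (c s A B : C) (r t : R) :
  (forall x, Psi (circle r x) = c + s * Phi (circle r x)) ->
  wdiff Phi (circle r t) A B ->
  circle_tangent Psi r t = s * circle_tangent Phi r t.
Proof.
  intros E HPhi. unfold circle_tangent.
  pose proof (wdiff_path Phi _ t _ A B (is_derive_circle r t) HPhi) as H1.
  set (v := A * (Ci * circle r t) + B * Cconj (Ci * circle r t)) in *.
  rewrite (Derive_RC_unique _ _ _ H1).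
  apply Derive_RC_unique.
  assert (Haff : wdiff (fun w => c + s * w) (Phi (circle r t)) s 0).
  { eapply wdiff_eq.
    - exact (wdiff_plus _ _ _ _ _ _ _ (wdiff_const c (Phi (circle r t)))
        (wdiff_mult _ _ _ _ _ _ _ (wdiff_const s _) (wdiff_id _))).
    - simpl. ring.
    - simpl. ring. }
  pose proof (wdiff_path _ _ t v s 0 H1 Haff) as H2.
  replace (s * v) with (s * v + 0 * Cconj v) by ring.
  unfold is_derive_RC in *.
  apply (@is_derive_ext R_AbsRing C_R_NormedModule
    (fun x => c + s * Phi (circle r x))); [|exact H2].
  intros x. symmetry. apply E.
Qed.

(* Multiplying all the tangents of a circle by the same nonzero number shifts
   their argument by a constant. *)
Lemma convex_scaled_tangent (Phi Psi : C -> C) (s : R -> C) :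
  univalent_on_disk Psi -> polyharmonic_on_disk Psi ->
  (forall r, (0 < r < 1)%R -> s r <> 0) ->
  (forall r t, (0 < r < 1)%R ->
     circle_tangent Psi r t = s r * circle_tangent Phi r t) ->
  convex_on_disk Phi -> convex_on_disk Psi.
Proof.
  intros Hu Hp Hs E (_ & _ & Hne & Harg).
  split; [exact Hu|]. split; [exact Hp|]. split.
  - intros r t Hr. rewrite E by exact Hr. apply Cmult_neq_0; auto.
  - intros r Hr. destruct (Harg r Hr) as (theta & [Hc Ht] & Hd).
    (* An argument of [s r] is the same for all t, so adding it to [theta] leaves the derivative
       unchanged. *)
    destruct (Cpolar (s r)) as [phi Hphi].
    exists (fun t => phi + theta t)%R. split; [split|].
    + intros t. apply (continuous_plus (fun _ : R => phi) theta).
      * apply continuous_const.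
      * apply Hc.
    + intros t. rewrite E by exact Hr.
      rewrite Cmod_mult, RtoC_mult, Cexp_Ci_plus.
      rewrite (Ht t) at 1. rewrite Hphi at 1. ring.
    + intros t. destruct (Hd t) as [Hex Hpos].
      assert (HD : is_derive (fun t => phi + theta t)%R t (Derive theta t)).
      { auto_derive; [exact Hex|]. rewrite Rmult_1_l. apply Derive_ext. reflexivity. }
      split; [eexists; exact HD|].
      apply is_derive_unique in HD.
      apply Rlt_le_trans with (1 := Hpos), Req_le, eq_sym, HD.
Qed.

Theorem theorem4 :
  forall (p : nat) (hp : (1 <= p)%nat)
    (G logG : C -> C)
    (hG : nonvanishing_log_harmonic G)
    (hlogG : log_harmonic_log G logG)
    (lambda : nat -> C)
    (f h : C -> C) (cf ch logf logh : C)
    (hcf : cf <> 0) (hch : ch <> 0)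
    (hf : forall z : C, in_disk z -> f z = cf)
    (hh : forall z : C, in_disk z -> h z = ch)
    (hlogf : Cexp logf = cf) (hlogh : Cexp logh = ch)
    (F logF : C -> C)
    (hF : forall z : C, in_disk z ->
       F z = f z * h (Cconj z) *
             Cprod_1 p (fun k => power (exponent lambda k z) (logG z)))
    (hlogF : forall z : C, in_disk z ->
       logF z = logf + logh + exponent_sum p lambda z * logG z)
    (hGuniv : univalent_on_disk logG)
    (hFuniv : univalent_on_disk logF)
    (hL : forall z : C, in_disk z -> z <> 0 -> L_op logG z <> 0)
    (hS : forall z : C, in_disk z -> z <> 0 -> exponent_sum p lambda z <> 0),
  convex_on_disk logG <-> convex_on_disk logF.
Proof.
  intros.
  destruct hlogG as (g1 & g2 & l1 & l2 & _ & (Hl1 & _) & (Hl2 & _) & El).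
  (* The case j = 0, where |z|^0 = 1: order 1 is harmonicity. *)
  assert (AG : almansi 1 logG).
  { apply almansi_ext with (1 := almansi_Cmod_pow_mult 1 0 l1 l2
      Nat.lt_0_1 Hl1 Hl2).
    intros z Hz. rewrite (El z Hz). simpl. ring. }
  assert (AF : almansi p logF).
  { apply almansi_ext with (1 := almansi_plus p _ _
      (almansi_const p (logf + logh) hp)
      (almansi_exponent_sum p p lambda l1 l2 (le_n p) Hl1 Hl2)).
    intros z Hz. now rewrite (hlogF z Hz), (El z Hz). }
  assert (Hcirc : forall r t, (0 < r < 1)%R -> in_disk (circle r t)).
  { intros r t Hr. unfold in_disk. rewrite Cmod_circle; lra. }
  (* The exponent depends on |z| alone, so its value at the point of angle 0 is its value on the
     whole circle. *)
  set (S := fun r => exponent_sum p lambda (circle r 0)).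
  assert (HS0 : forall r, (0 < r < 1)%R -> S r <> 0).
  { intros r Hr. apply hS; [now apply Hcirc|].
    apply Cmod_gt_0. rewrite Cmod_circle; lra. }
  assert (HT : forall r t, (0 < r < 1)%R ->
    circle_tangent logF r t = S r * circle_tangent logG r t).
  { intros r t Hr.
    destruct (almansi_derivatives 1 logG AG)
      as (fz & fzb & _ & _ & _ & HD & _).
    apply (circle_tangent_affine logG logF (logf + logh) (S r) _ _ r t)
      with (2 := HD _ (Hcirc r t Hr)).
    intros x. rewrite hlogF by now apply Hcirc.
    unfold S, exponent_sum, exponent. rewrite !Cmod_circle by lra. reflexivity. }
  split.
  - apply (convex_scaled_tangent logG logF S); trivial.
    now apply (almansi_polyharmonic p).
  - apply (convex_scaled_tangent logF logG (fun r => / S r)); trivial.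
    + now apply (almansi_polyharmonic 1).
    + intros r Hr HE. apply (HS0 r Hr).
      (* [/ S r] is shown nonzero by writing S(r) as a multiple of it: were it zero, S(r) would be
         zero as well. *)
      replace (S r) with (S r * S r * / S r) by (field; auto).
      rewrite HE. ring.
    + intros r t Hr. rewrite HT by exact Hr. field. auto.
Qed.
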